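(* Let $M$ be the monoid presented by the rewriting system $$e^3 \rightarrow e,\qquad xey \rightarrow y,\qquad xe^2y \rightarrow x,\qquad xy \rightarrow 1$$ over the alphabet $A = \{x,y,e\}$; that is, $M$ is the monoid with presentation $\langle x,y,e \mid e^3 = e,\ xey = y,\ xe^2y = x,\ xy = 1\rangle$. Then $M$ is congruence-free and simple but not bisimple.
   Context: The monoid presented by a rewriting system over an alphabet $A$ is the quotient of the free monoid $A^*$ by the smallest congruence containing all pairs $(\ell, r)$ with $\ell \rightarrow r$ a rule; here $1$ denotes the empty word (the identity element). A congruence on a monoid $M$ is an equivalence relation $\rho$ on $M$ such that $u \mathrel{\rho} v$ implies $puq \mathrel{\rho} pvq$ for all $p,q \in M$. A monoid $M$ is congruence-free if its only congruences are the equality relation and the universal relation $M \times M$. Green's relations on $M$: $a \mathrel{\mathcal{L}} b$ iff $Ma = Mb$; $a \mathrel{\mathcal{R}} b$ iff $aM = bM$; $a \mathrel{\mathcal{J}} b$ iff $MaM = MbM$; and $\mathcal{D} = \mathcal{L} \circ \mathcal{R} = \mathcal{R}\circ\mathcal{L}$. The monoid $M$ is simple if all its elements are $\mathcal{J}$-related (equivalently, its only two-sided ideal other than the empty set is $M$), and bisimple if all its elements are $\mathcal{D}$-related. *)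

(* Defs.v *)
From HB Require Import structures.
From mathcomp Require Import all_boot.
From mathcomp Require Import boolp classical_sets.

Set Implicit Arguments.
Unset Strict Implicit.
Unset Printing Implicit Defensive.

Import Algebra.

Local Open Scope classical_set_scope.
Local Open Scope group_scope.
Local Open Scope quotient_scope.

Section Monoids.
Variable M : monoidType.

Definition congruence (rho : M -> M -> Prop) : Prop :=
  RelationClasses.Equivalence rho /\
  forall u v p q : M, rho u v -> rho (p * u * q) (p * v * q).

Definition congruence_free : Prop :=
  forall rho : M -> M -> Prop, congruence rho ->
    (forall u v, rho u v <-> u = v) \/ (forall u v, rho u v).

Definition green_L (a b : M) : Prop :=
  [set m * a | m in [set: M]] = [set m * b | m in [set: M]].

Definition green_R (a b : M) : Prop :=
  [set a * m | m in [set: M]] = [set b * m | m in [set: M]].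

Definition green_J (a b : M) : Prop :=
  [set p * a * q | p in [set: M] & q in [set: M]] =
  [set p * b * q | p in [set: M] & q in [set: M]].

Definition green_D (a b : M) : Prop :=
  exists c : M, green_L a c /\ green_R c b.

Definition simple_monoid : Prop := forall a b : M, green_J a b.

Definition bisimple_monoid : Prop := forall a b : M, green_D a b.

End Monoids.

Arguments congruence_free M : clear implicits.
Arguments simple_monoid M : clear implicits.
Arguments bisimple_monoid M : clear implicits.

(* [word A] is an alias of [seq A] carrying the free monoid structure. *)
Definition word (A : Type) : Type := seq A.

HB.instance Definition _ (A : choiceType) := Choice.copy (word A) (seq A).
HB.instance Definition _ (A : choiceType) :=
  isMonoid.Build (word A) (@catA A) (@cat0s A) (@cats0 A).

Section Presentation.
Variables (A : choiceType) (R : word A -> word A -> Prop).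

(* The smallest congruence containing [R], as the intersection of all of them. *)
Definition generated_congruence (u v : word A) : Prop :=
  forall rho : word A -> word A -> Prop,
    congruence rho -> (forall l r, R l r -> rho l r) -> rho u v.

Lemma generated_congruenceP : congruence generated_congruence.
Proof.
split; first split.
- by move=> u rho [[rfl _ _] _] _; exact: rfl.
- move=> u v uv rho crho Rrho; case: (crho) => -[_ sym _] _.
  exact: (sym _ _ (uv _ crho Rrho)).
- move=> u v w uv vw rho crho Rrho; case: (crho) => -[_ _ tr] _.
  exact: (tr _ v _ (uv _ crho Rrho) (vw _ crho Rrho)).
- move=> u v p q uv rho crho Rrho; case: (crho) => _ cmp.
  exact: (cmp _ _ p q (uv _ crho Rrho)).
Qed.

Lemma generated_congruence_sub l r : R l r -> generated_congruence l r.
Proof. by move=> Rlr rho _; apply. Qed.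

(* [{eq_quot _}] needs a boolean relation, whence the classical [`[< _ >]]. *)
Definition generated_congruenceb (u v : word A) : bool :=
  `[< generated_congruence u v >].

Lemma generated_congruenceb_refl : reflexive generated_congruenceb.
Proof.
case: generated_congruenceP => -[rfl _ _] _ u.
by apply/asboolP; exact: rfl.
Qed.

Lemma generated_congruenceb_sym : symmetric generated_congruenceb.
Proof.
case: generated_congruenceP => -[_ sym _] _ u v.
by apply/asboolP/asboolP; exact: sym.
Qed.

Lemma generated_congruenceb_trans : transitive generated_congruenceb.
Proof.
case: generated_congruenceP => -[_ _ tr] _ v u w /asboolP uv /asboolP vw.
apply/asboolP; exact: (tr _ v).
Qed.

Canonical generated_equiv := EquivRel generated_congruenceb
  generated_congruenceb_refl generated_congruenceb_sym
  generated_congruenceb_trans.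

Definition presented_monoid : Type := {eq_quot generated_equiv}.

HB.instance Definition _ := Choice.on presented_monoid.
HB.instance Definition _ := EqQuotient.on presented_monoid.

Definition word_class (w : word A) : presented_monoid := \pi_presented_monoid w.

Lemma word_classE u v :
  word_class u = word_class v <-> generated_congruence u v.
Proof.
rewrite /word_class; split=> [/eqP|uv]; first by rewrite piE => /asboolP.
by apply/eqP; rewrite piE; exact/asboolP.
Qed.

Definition presented_one : presented_monoid := word_class 1.

Definition presented_mul (a b : presented_monoid) : presented_monoid :=
  word_class (repr a * repr b).

Lemma word_classM u v :
  word_class (u * v) = presented_mul (word_class u) (word_class v).
Proof.
have reprP w : generated_congruence w (repr (word_class w)).
  by apply/word_classE; rewrite /word_class reprK.
apply/word_classE; case: generated_congruenceP => -[_ _ tr] cmp.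
apply: (tr _ (repr (word_class u) * v)).
  by have := cmp _ _ 1 v (reprP u); rewrite !mul1g.
by have := cmp _ _ (repr (word_class u)) 1 (reprP v); rewrite !mulg1.
Qed.

Lemma word_class_surj (a : presented_monoid) : exists w, a = word_class w.
Proof. by exists (repr a); rewrite /word_class reprK. Qed.

Lemma presented_mulA : associative presented_mul.
Proof.
move=> a b c; have [u ->] := word_class_surj a.
have [v ->] := word_class_surj b; have [w ->] := word_class_surj c.
by rewrite -!word_classM mulgA.
Qed.

Lemma presented_mul1g : left_id presented_one presented_mul.
Proof.
move=> a; have [u ->] := word_class_surj a.
by rewrite -word_classM mul1g.
Qed.

Lemma presented_mulg1 : right_id presented_one presented_mul.
Proof.
move=> a; have [u ->] := word_class_surj a.
by rewrite -word_classM mulg1.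
Qed.

HB.instance Definition _ := isMonoid.Build presented_monoid
  presented_mulA presented_mul1g presented_mulg1.

End Presentation.

Inductive letter : Type := letter_x | letter_y | letter_e.

Definition nat_of_letter (a : letter) : nat :=
  match a with letter_x => 0 | letter_y => 1 | letter_e => 2 end.

Definition letter_of_nat (n : nat) : letter :=
  match n with 0 => letter_x | 1 => letter_y | _ => letter_e end.

Lemma nat_of_letterK : cancel nat_of_letter letter_of_nat.
Proof. by case. Qed.

HB.instance Definition _ := Countable.copy letter (can_type nat_of_letterK).

Inductive rule : word letter -> word letter -> Prop :=
| rule_eee : rule [:: letter_e; letter_e; letter_e] [:: letter_e]
| rule_xey : rule [:: letter_x; letter_e; letter_y] [:: letter_y]
| rule_xeey : rule [:: letter_x; letter_e; letter_e; letter_y] [:: letter_x]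
| rule_xy : rule [:: letter_x; letter_y] [::].

(* Main.v *)
(* Every element is a product of factors [a y], then of factors [x a], with [a]
   in [{1, e, e^2}] between and around them. Multiplying by suitable words on
   both sides turns any element into [1], so the monoid is simple. If a
   congruence identifies two elements whose normal forms differ, peel equal
   factors [a y] on the left and [x a] on the right until two different powers
   of [e] face each other; multiplying by words such as [x e^i] and [e^j y] then
   gives [x^n t ~ t] or [t y^n ~ t], whence [x^n ~ 1] or [y^n ~ 1], which
   collapses everything. This never uses that normal forms are unique.
   Finally [1 D e] would give [c] with [m c = 1], [c q = e] and [c] in [e M]:
   a left invertible normal form is [1] or contains [y], so [c] would begin with
   [a y], and an action on stacks shows that [a y w] is never [e]. *)
Require Import Defs.
From HB Require Import structures.
From mathcomp Require Import all_boot.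
From mathcomp Require Import boolp classical_sets.
From Stdlib Require Import Setoid Morphisms.

Set Implicit Arguments.
Unset Strict Implicit.
Unset Printing Implicit Defensive.

Import Algebra.

Local Open Scope group_scope.

(** * Consequences of the four relations in a monoid generated by [x], [y], [e] *)

Section Relations.
Variables (M : monoidType) (x y e : M).
Hypotheses (eee : e * e * e = e) (xey : x * e * y = y).
Hypotheses (xeey : x * e * e * y = x) (xy : x * y = 1).
Hypothesis generated : forall P : M -> Prop,
  P 1 -> (forall w, P w -> [/\ P (x * w), P (y * w) & P (e * w)]) ->
  forall w, P w.

(** Products are kept left-associated, so a relation inside a longer product occurs behind a prefix
    [m]; [reduce] holds each relation both bare and prefixed. *)
Let eeeK (m : M) : m * e * e * e = m * e.
Proof. by rewrite -!(mulgA m) eee. Qed.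
Let xeyK (m : M) : m * x * e * y = m * y.
Proof. by rewrite -!(mulgA m) xey. Qed.
Let xeeyK (m : M) : m * x * e * e * y = m * x.
Proof. by rewrite -!(mulgA m) xeey. Qed.
Let xyK (m : M) : m * x * y = m. Proof. by rewrite -mulgA xy mulg1. Qed.
Let reduce := (@mulgA M, @mul1g M, @mulg1 M, eee, xey, xeey, xy,
  eeeK, xeyK, xeeyK, xyK).

Lemma expxyK n : x ^+ n * y ^+ n = 1.
Proof.
elim: n => [|n IHn]; first by rewrite !expg0 mulg1.
by rewrite expgSr expgS !reduce.
Qed.

(** * Normal forms *)

Inductive e_power : M -> Prop :=
| e_power0 : e_power 1
| e_power1 : e_power e
| e_power2 : e_power (e * e).

(** This grows at the right end and [normal] at the left, exposing the factors to be peeled from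
    each side. *)
Inductive right_normal : M -> Prop :=
| right_normal_e a : e_power a -> right_normal a
| right_normal_x w a : right_normal w -> e_power a -> right_normal (w * x * a).

Inductive normal : M -> Prop :=
| normal_right w : right_normal w -> normal w
| normal_y a w : e_power a -> normal w -> normal (a * y * w).

Lemma e_power_mule a : e_power a -> e_power (e * a).
Proof. by case; rewrite ?reduce; constructor. Qed.

Lemma right_normal_mulx w : right_normal w -> right_normal (x * w).
Proof.
elim=> {w} [a ea|w a _ IHw ea]; last by rewrite !mulgA; constructor.
by rewrite -[x]mul1g; constructor=> //; do 2!constructor.
Qed.

Lemma right_normal_mule w : right_normal w -> right_normal (e * w).
Proof.
elim=> {w} [a ea|w a _ IHw ea]; first by constructor; exact: e_power_mule.
by rewrite !mulgA; constructor.
Qed.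

Lemma normal_muly w : normal w -> normal (y * w).
Proof. by move=> nw; rewrite -[y]mul1g; constructor=> //; constructor. Qed.

Lemma normal_mulx w : normal w -> normal (x * w).
Proof.
elim=> {w} [w rw|a w ea nw IHw]; first by constructor; exact: right_normal_mulx.
(* [x * a * y] is [1], [y] or [x]; the last value leads to the induction hypothesis. *)
by case: ea; rewrite !reduce //; exact: normal_muly.
Qed.

Lemma normal_mule w : normal w -> normal (e * w).
Proof.
elim=> {w} [w rw|a w ea nw IHw]; first by constructor; exact: right_normal_mule.
by rewrite !mulgA; constructor=> //; exact: e_power_mule.
Qed.

Lemma normalP w : normal w.
Proof.
apply: (@generated normal); first by do 3!constructor.
by move=> {}w nw; split;
  [exact: normal_mulx | exact: normal_muly | exact: normal_mule].
Qed.

(** * One-sided inverses and simplicity *)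

Lemma e_power_linv a : e_power a -> exists p, p * a * y = 1.
Proof.
by case; [exists x | exists (x * x) | exists (x * x * e)]; rewrite !reduce.
Qed.

Lemma e_power_rinv a : e_power a -> exists q, x * a * q = 1.
Proof.
by case; [exists y | exists (e * y * y) | exists (y * y)]; rewrite !reduce.
Qed.

(** The extra [x] makes the initial power of [e] right invertible by [e_power_rinv]; every later
    power has its own [x]. *)
Lemma right_normal_rinv w : right_normal w -> exists q, x * w * q = 1.
Proof.
elim=> {w} [a /e_power_rinv//|w a _ [q xwq] /e_power_rinv[r xar]].
by exists (r * q); rewrite !mulgA -(mulgA _ x) -(mulgA _ (x * a)) xar mulg1.
Qed.

Lemma right_normal_to_e_power w :
  right_normal w -> exists q, e_power (w * q).
Proof.
elim=> {w} [a ea|w a _ [q ewq] /e_power_rinv[r xar]].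
  by exists 1; rewrite ?mulg1.
by exists (r * q); rewrite !mulgA -(mulgA w) -(mulgA w) xar mulg1.
Qed.

Lemma normal_inv w : normal w -> exists p q, p * w * q = 1.
Proof.
elim=> {w} [w /right_normal_rinv[q xwq]|a w ea _ [p [q pwq]]]; first by exists x, q.
have [r ray] := e_power_linv ea.
by exists (p * r), q; rewrite !mulgA -(mulgA p) -(mulgA p) ray mulg1.
Qed.

Lemma simple_of_relations : simple_monoid M.
Proof.
have full (a : M) :
    [set p * a * q | p in [set: M] & q in [set: M]]%classic = [set: M]%classic.
  apply/seteqP; split=> // c _; have [p [q paq]] := normal_inv (normalP a).
  exists (c * p) => //; exists q => //.
  by rewrite -!mulgA (mulgA p) paq mulg1.
by move=> a b; rewrite /green_J !full.
Qed.

(** * Identities that force a congruence to be universal *)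

Section Congruence.
Variable rho : M -> M -> Prop.
Hypothesis rhoC : congruence rho.

Local Notation universal := (forall u v, rho u v).

Let rho_equiv : Equivalence rho := proj1 rhoC.
Local Existing Instance rho_equiv.

Let rho_refl u : rho u u. Proof. reflexivity. Qed.
Local Hint Resolve rho_refl : core.

Let rhoM p q u v : rho u v -> rho (p * u * q) (p * v * q).
Proof. exact: (proj2 rhoC). Qed.

Let rho_mul : Proper (rho ==> rho ==> rho) (@mul M).
Proof.
move=> u u' uu' v v' vv'; transitivity (u' * v).
  by have := rhoM 1 v uu'; rewrite !mul1g.
by have := rhoM u' 1 vv'; rewrite !mulg1.
Qed.
Local Existing Instance rho_mul.

(** Putting [y * x ~ 1] on both sides of [e] and of [e * e] exposes [x * e * y] and [x * e * e * y],
    so [e ~ y] and [e * e ~ x]. Then [e = e * e * e ~ y * x ~ 1], and all generators collapse. *)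
Lemma universal_yx : rho (y * x) 1 -> universal.
Proof.
move=> yx.
have ey : rho e y.
  have : rho (y * x * e * (y * x)) (y * (y * x)) by rewrite !reduce.
  by rewrite yx mul1g !mulg1.
have eex : rho (e * e) x.
  have : rho (y * x * (e * e) * (y * x)) (y * x * x) by rewrite !reduce.
  by rewrite yx !mul1g mulg1.
have e1 : rho 1 e.
  by have : rho (e * (e * e)) e; [rewrite mulgA eee | rewrite eex {1}ey yx].
have x1 : rho x 1 by rewrite -eex -e1 mulg1.
have y1 : rho y 1 by rewrite -ey -e1.
have all1 w : rho w 1.
  apply: (@generated (fun w => rho w 1)) => [|{}w w1]; first by [].
  by split; rewrite w1 mulg1 -?e1.
by move=> u v; rewrite (all1 u) (all1 v).
Qed.

(** Right multiplication by [y] gives [y ~ x ^+ n], whence [y * x ~ 1]. *)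
Lemma universal_expx n : rho (x ^+ n.+1) 1 -> universal.
Proof.
move=> xn; apply: universal_yx.
have ye : rho y (x ^+ n).
  by have := rhoM 1 y xn; rewrite expgSr !reduce; symmetry.
by rewrite ye -expgSr.
Qed.

Lemma universal_expy n : rho (y ^+ n.+1) 1 -> universal.
Proof.
move=> yn; apply: universal_yx.
have xe : rho x (y ^+ n).
  by have := rhoM x 1 yn; rewrite expgS !reduce; symmetry.
by rewrite xe -expgS.
Qed.

(* [x * x] on the left of [x ^+ a * t] absorbs the first [b * y] of the normal
   form of [t] into a power of [x], whatever [b] is. *)
Lemma universal_expx_mul t a n :
  rho (x ^+ (a + n.+1) * t) (x ^+ a * t) -> universal.
Proof.
elim: {t}(normalP t) a => [w rw|b w eb _ IHw] a H.
  have [q xwq] := right_normal_rinv rw.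
  have key m : x * (x ^+ m * w) * q = x ^+ m.
    by rewrite mulgA -expgS expgSr -!mulgA (mulgA x) xwq mulg1.
  apply: (@universal_expx n).
  (* Once [w] is cancelled, [y ^+ a] removes the common power [x ^+ a]. *)
  have := rhoM 1 (y ^+ a) (rhoM x q H).
  by rewrite !key !mul1g addnC expgnDr -mulgA expxyK mulg1.
have [m xxby] : exists m, x * x * b * y = x ^+ m.
  by case: eb; [exists 1%N | exists 0%N | exists 2%N]; rewrite !reduce.
have key c : x * x * (x ^+ c * (b * y * w)) = x ^+ (c + m) * w.
  have xxC : x * x * x ^+ c = x ^+ c * x * x by rewrite -!expgSr -mulgA -!expgS.
  by rewrite expgnDr -xxby !mulgA xxC.
apply: (IHw (a + m)%N); rewrite addnAC -!key.
by have := rhoM (x * x) 1 H; rewrite !mulg1.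
Qed.

(** The factors [b * y] of [t] are cancelled from the left; then [y * y] on the right absorbs each
    last [x * b] into a power of [y], which changes [a]. *)
Lemma universal_mul_expy t a n :
  rho (t * y ^+ (a + n.+1)) (t * y ^+ a) -> universal.
Proof.
have yyC c : y ^+ c * y * y = y * y * y ^+ c.
  by rewrite -!expgSr -mulgA -!expgS.
elim: {t}(normalP t) a => [w rw|b w eb _ IHw] a H; last first.
  have [p pby] := e_power_linv eb.
  apply: (IHw a); have := rhoM p 1 H.
  by rewrite !mulg1 !mulgA pby !mul1g.
elim: rw a H => {w} [b eb|w b rw IHw eb] a H.
  have [p pby] := e_power_linv eb.
  have key m : p * (b * y ^+ m) * y = y ^+ m.
    by rewrite -!mulgA -expgSr expgS !mulgA pby mul1g.
  apply: (@universal_expy n).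
  have := rhoM (x ^+ a) 1 (rhoM p y H).
  by rewrite !key !mulg1 expgnDr mulgA expxyK mul1g.
have [m xbyy] : exists m, x * b * y * y = y ^+ m.
  by case: eb; [exists 1%N | exists 2%N | exists 0%N]; rewrite !reduce.
have key c : w * x * b * y ^+ c * (y * y) = w * y ^+ (m + c).
  by rewrite expgnDr -xbyy -!mulgA (mulgA (y ^+ c)) yyC !mulgA.
apply: (IHw (m + a)%N); rewrite -addnA -!key.
by have := rhoM 1 (y * y) H; rewrite !mul1g.
Qed.

(** * Peeling factors off both sides of an identity *)

(** For distinct [a], [b], two left multipliers give two relations between [u] and [v]; eliminating
    one of these leaves [x ^+ k * t ~ t] with [k > 0]. *)
Lemma rho_left_cancel a b u v : e_power a -> e_power b ->
  rho (a * y * u) (b * y * v) -> a = b /\ rho u v \/ universal.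
Proof.
have neq01 s t : rho (y * s) (e * y * t) -> universal.
  move=> H; have Hx := rhoM x 1 H; have Hxee := rhoM (x * e * e) 1 H.
  move: Hx Hxee; rewrite !reduce => Hx Hxee.
  by apply: (@universal_expx_mul s 0 0); rewrite expg1 expg0 mul1g Hxee Hx.
have neq02 s t : rho (y * s) (e * e * y * t) -> universal.
  move=> H; have Hx := rhoM x 1 H; have Hxxe := rhoM (x * x * e) 1 H.
  move: Hx Hxxe; rewrite !reduce => Hx Hxxe.
  by apply: (@universal_expx_mul t 0 0); rewrite expg1 expg0 mul1g -Hx Hxxe.
have neq12 s t : rho (e * y * s) (e * e * y * t) -> universal.
  move=> H; have Hxx := rhoM (x * x) 1 H; have Hxxe := rhoM (x * x * e) 1 H.
  move: Hxx Hxxe; rewrite !reduce => Hxx Hxxe.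
  (* [s ~ x * x * t] and [x * x * s ~ t] combine to [x ^+ 4 * t ~ t]. *)
  apply: (@universal_expx_mul t 0 3).
  by rewrite expg0 mul1g -[X in rho _ X]Hxxe Hxx !expgS expg0 !reduce.
have cancel c s t : e_power c -> rho (c * y * s) (c * y * t) -> rho s t.
  move=> /e_power_linv[p pcy] /(rhoM p 1).
  by rewrite !mulg1 !mulgA pcy !mul1g.
move=> ea eb H.
case: ea eb H => -[] H; move: (H); rewrite ?mul1g => H';
  try by [left; split=> //; apply: cancel H; constructor];
  right; first [exact: neq01 H' | exact: neq02 H' | exact: neq12 H'
               | symmetry in H'; first [exact: neq01 H' | exact: neq02 H'
                                       | exact: neq12 H']].
Qed.

Lemma rho_right_cancel a b u v : e_power a -> e_power b ->
  rho (u * x * a) (v * x * b) -> a = b /\ rho u v \/ universal.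
Proof.
have neq01 s t : rho (s * x) (t * x * e) -> universal.
  move=> H; have Hy := rhoM 1 y H; have Heeyy := rhoM 1 (e * e * y * y) H.
  move: Hy Heeyy; rewrite !reduce => Hy Heeyy.
  (* Here [s ~ t * y] and [s ~ t * y * y], so one [y] remains on the smaller side. *)
  apply: (@universal_mul_expy t 1 0).
  by rewrite !expgS expg0 !reduce; transitivity s; [symmetry|].
have neq02 s t : rho (s * x) (t * x * e * e) -> universal.
  move=> H; have Hyy := rhoM 1 (y * y) H; have Hey := rhoM 1 (e * y) H.
  move: Hyy Hey; rewrite !reduce => Hyy Hey.
  by apply: (@universal_mul_expy t 0 0); rewrite expg1 expg0 mulg1 -Hey Hyy.
have neq12 s t : rho (s * x * e) (t * x * e * e) -> universal.
  move=> H; have Hyy := rhoM 1 (y * y) H; have Heyy := rhoM 1 (e * y * y) H.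
  move: Hyy Heyy; rewrite !reduce => Hyy Heyy.
  apply: (@universal_mul_expy t 0 3).
  by rewrite expg0 mulg1 -[X in rho _ X]Hyy Heyy !expgS expg0 !reduce.
have cancel c s t : e_power c -> rho (s * x * c) (t * x * c) -> rho s t.
  move=> /e_power_rinv[q xcq] /(rhoM 1 q).
  by rewrite !mul1g -!mulgA !(mulgA x) xcq !mulg1.
move=> ea eb H.
case: ea eb H => -[] H; move: (H); rewrite ?mulgA ?mulg1 => H';
  try by [left; split=> //; apply: cancel H; constructor];
  right; first [exact: neq01 H' | exact: neq02 H' | exact: neq12 H'
               | symmetry in H'; first [exact: neq01 H' | exact: neq02 H'
                                       | exact: neq12 H']].
Qed.

(** * Comparing normal forms *)

(** Two left multipliers bring the side containing [w] to the same element and the other side to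
    [x ^+ 4] and to [1]. *)
Lemma universal_y_e_power a b w : e_power a -> e_power b ->
  rho (a * y * w) b -> universal.
Proof.
have key1 : rho (e * y * w) e -> universal.
  move=> H; have H1 := rhoM (x * x * x * x) (e * y) H.
  have H2 := rhoM (x * x * e) (e * y) H; apply: (@universal_expx 3).
  move: H1 H2; rewrite !expgS expg0 !reduce => H1 H2.
  by rewrite -H1 H2.
have key2 : rho (e * y * w) (e * e) -> universal.
  move=> H; have H1 := rhoM (x * x * x * x) y H.
  have H2 := rhoM (x * x * e) y H; apply: (@universal_expx 3).
  move: H1 H2; rewrite !expgS expg0 !reduce => H1 H2.
  by rewrite -H1 H2.
move=> ea eb H.
(* Left multiplication by [e] or [e * e] turns [a] into [e] and [b] into [e] or [e * e]. *)
case: ea eb H => -[] H; 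
  first [ move: (rhoM e 1 H); rewrite !reduce; first [exact: key1 | exact: key2]
        | move: (rhoM (e * e) 1 H); rewrite !reduce;
          first [exact: key1 | exact: key2]].
Qed.

Lemma universal_x_e_power a b w : e_power a -> e_power b ->
  rho (w * x * a) b -> universal.
Proof.
have key1 : rho (w * x * e) e -> universal.
  move=> H; have H1 := rhoM (x * e) (e * y * y * y * y) H.
  have H2 := rhoM (x * e) (y * y) H; apply: (@universal_expy 3).
  move: H1 H2; rewrite !expgS expg0 !reduce => H1 H2.
  by rewrite -H1 H2.
have key2 : rho (w * x * e) (e * e) -> universal.
  move=> H; have H1 := rhoM x (e * y * y * y * y) H.
  have H2 := rhoM x (y * y) H; apply: (@universal_expy 3).
  move: H1 H2; rewrite !expgS expg0 !reduce => H1 H2.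
  by rewrite -H1 H2.
move=> ea eb H.
case: ea eb H => -[] H; 
  first [ move: (rhoM 1 e H); rewrite !reduce; first [exact: key1 | exact: key2]
        | move: (rhoM 1 (e * e) H); rewrite !reduce;
          first [exact: key1 | exact: key2]].
Qed.

(** Passing from [a] to [x * a * y] sends [1], [e], [e * e] to [1], [y], [x], and identifying any
    two of these collapses everything. *)
Lemma e_power_eq_or_universal a b : e_power a -> e_power b ->
  rho a b -> a = b \/ universal.
Proof.
have y1 : rho 1 y -> universal.
  by move=> H; apply: (@universal_expy 0); symmetry.
have x1 : rho 1 x -> universal.
  by move=> H; apply: (@universal_expx 0); symmetry.
have yx1 : rho y x -> universal.
  move=> /(rhoM x 1); rewrite !reduce => H.
  by apply: (@universal_expx 1); symmetry.
move=> ea eb H.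
case: ea eb H => -[] H; try by [left];
  right; move: (rhoM x y H); rewrite !reduce => H';
  first [exact: y1 H' | exact: x1 H' | exact: yx1 H'
        | symmetry in H'; first [exact: y1 H' | exact: x1 H' | exact: yx1 H']].
Qed.

Lemma right_normal_eq_or_universal u v : right_normal u -> right_normal v ->
  rho u v -> u = v \/ universal.
Proof.
move=> ru; elim: ru v => {u} [a ea|u a ru IHu ea] v [b eb|{}v b rv eb] H.
- exact: e_power_eq_or_universal.
- by symmetry in H; right; exact: universal_x_e_power H.
- by right; exact: universal_x_e_power H.
- case: (rho_right_cancel ea eb H) => [[-> uv]|]; last by right.
  by case: (IHu _ rv uv) => [->|]; [left | right].
Qed.

Lemma universal_y_right_normal a w v : e_power a -> right_normal v ->
  rho (a * y * w) v -> universal.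
Proof.
move=> ea /right_normal_to_e_power[q evq] /(rhoM 1 q).
by rewrite !mul1g -mulgA; exact: universal_y_e_power.
Qed.

Lemma normal_eq_or_universal u v : normal u -> normal v ->
  rho u v -> u = v \/ universal.
Proof.
move=> nu; elim: nu v => {u} [u ru|a u ea nu IHu] v [{}v rv|b {}v eb nv] H.
- exact: right_normal_eq_or_universal.
- by symmetry in H; right; exact: universal_y_right_normal H.
- by right; exact: universal_y_right_normal H.
- case: (rho_left_cancel ea eb H) => [[-> uv]|]; last by right.
  by case: (IHu _ nv uv) => [->|]; [left | right].
Qed.

End Congruence.

(** * Congruence-freeness and the obstruction to bisimplicity *)

Lemma congruence_free_of_relations : congruence_free M.
Proof.
move=> rho rhoC; case: (pselect (forall u v, rho u v)) => [U|nU]; first by right.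
left=> u v; split=> [uv|->]; last by case: rhoC => -[].
by case: (normal_eq_or_universal rhoC (normalP u) (normalP v) uv).
Qed.

Lemma not_bisimple_of_relations :
  (forall m, m * e <> 1) -> (forall m, m * x <> 1) -> (forall m, e * m <> 1) ->
  (forall a w, e_power a -> a * y * w <> e) -> ~ bisimple_monoid M.
Proof.
move=> me1 mx1 em1 eywe /(_ 1 e) [c [L1c Rce]].
have /= [m _ mc1] : ([set m * c | m in [set: M]] 1)%classic.
  by rewrite -L1c; exists 1; rewrite // mulg1.
have /= [q _ cqe] : ([set c * m | m in [set: M]] e)%classic.
  by rewrite Rce; exists 1; rewrite // mulg1.
have /= [p _ epc] : ([set e * m | m in [set: M]] c)%classic.
  by rewrite -Rce; exists 1; rewrite // mulg1.
(* [e * p = c] excludes [c = 1], [m * c = 1] excludes the other powers of [e] and an ending [x * a],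
   and [c * q = e] excludes a beginning [a * y]. *)
case: (normalP c) epc cqe mc1 =>
    [{c L1c Rce}w [a ea|{}w a _ ea]|a w ea _] epc cqe mc1.
- case: ea epc mc1 => epc mc1; [exact: em1 epc | exact: me1 mc1 |].
  by apply: (me1 (m * e)); rewrite -mulgA.
- case: ea mc1; rewrite !mulgA => mc1.
  + by rewrite mulg1 in mc1; exact: mx1 mc1.
  + exact: me1 mc1.
  + exact: me1 mc1.
- by apply: (eywe a (w * q)) => //; rewrite mulgA.
Qed.

End Relations.

(** * The action on stacks *)

(* A state [(n, s)] stands for [e^n y e^(s_0) y e^(s_1) ...]; a stack of [y]s is
   enough here, so [x] may do anything on the empty one. *)
Definition run_succ (n : nat) : nat := (if n is 1 then 2 else 1)%N.

(** The branches are [x * y = 1], [x * e * y = y] and [x * e * e * y = x]; in the last, [x] survives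
    and meets the next run. Runs above 2 count as 2. *)
Fixpoint pop (n : nat) (s : seq nat) : nat * seq nat :=
  match s with
  | [::] => (0, [::])
  | m :: s' => match n with
               | 0 => (m, s')
               | 1%N => (0, m :: s')
               | _ => pop m s'
               end
  end.

Definition letter_act (l : letter) (u : nat * seq nat) : nat * seq nat :=
  match l with
  | letter_x => pop u.1 u.2
  | letter_y => (0, u.1 :: u.2)
  | letter_e => (run_succ u.1, u.2)
  end.

Definition word_act (w : word letter) (u : nat * seq nat) : nat * seq nat :=
  foldr letter_act u w.

Lemma word_actM v w u : word_act (v * w) u = word_act v (word_act w u).
Proof. exact: foldr_cat. Qed.

(** Acting equally on all states is a congruence containing the rules. *)
Lemma word_act_congruent v w u :
  generated_congruence rule v w -> word_act v u = word_act w u.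
Proof.
move=> /(_ (fun v w => forall u, word_act v u = word_act w u)); apply.
  split; first split.
  - by [].
  - by move=> ? ? E ?; rewrite E.
  - by move=> ? ? ? E F ?; rewrite E F.
  by move=> a b p q E u'; rewrite !word_actM E.
by move=> l r [] [[|[|n]] s].
Qed.

(** * Transfer to the presented monoid *)

Definition presented_act (a : presented_monoid rule) (u : nat * seq nat) :=
  word_act (repr a) u.

Lemma presented_act_class w u : presented_act (word_class rule w) u = word_act w u.
Proof.
by apply: word_act_congruent; apply/word_classE; rewrite /word_class reprK.
Qed.

Lemma presented_actM a b u :
  presented_act (a * b) u = presented_act a (presented_act b u).
Proof. by rewrite presented_act_class word_actM. Qed.

Lemma presented_act1 u : presented_act 1 u = u.
Proof. exact: presented_act_class. Qed.

Definition generator (l : letter) : presented_monoid rule := word_class rule [:: l].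

Lemma presented_act_generator l u : presented_act (generator l) u = letter_act l u.
Proof. exact: presented_act_class. Qed.

Lemma word_class_mul v w :
  word_class rule (v * w) = word_class rule v * word_class rule w.
Proof. exact: word_classM. Qed.

Lemma presented_generated (P : presented_monoid rule -> Prop) :
  P 1 ->
  (forall w, P w -> [/\ P (generator letter_x * w), P (generator letter_y * w)
                      & P (generator letter_e * w)]) ->
  forall w, P w.
Proof.
move=> P1 PS a; have [w ->] := word_class_surj a.
elim: w => [//|l w /PS[Px Py Pe]].
have -> : word_class rule (l :: w) = generator l * word_class rule w.
  exact: (word_class_mul [:: l] w).
by case: l.
Qed.

Theorem mainTheorem1 :
  congruence_free (presented_monoid rule) /\
  simple_monoid (presented_monoid rule) /\
  ~ bisimple_monoid (presented_monoid rule).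
Proof.
pose x := generator letter_x; pose y := generator letter_y.
pose e := generator letter_e.
have relation l r : rule l r -> word_class rule l = word_class rule r.
  by move=> lr; apply/word_classE; exact: generated_congruence_sub.
have eee : e * e * e = e.
  by rewrite /e /generator -!word_class_mul; apply: relation; exact: rule_eee.
have xey : x * e * y = y.
  by rewrite /x /y /e /generator -!word_class_mul; apply: relation; exact: rule_xey.
have xeey : x * e * e * y = x.
  by rewrite /x /y /e /generator -!word_class_mul; apply: relation; exact: rule_xeey.
have xy : x * y = 1.
  by rewrite /x /y /generator -!word_class_mul; apply: relation; exact: rule_xy.
have gen := presented_generated.
have actE := (presented_actM, presented_act1, presented_act_generator).
(* A left invertible element acts injectively. *)
have not_linv l u v : u <> v -> letter_act l u = letter_act l v ->
    forall m, m * generator l <> 1.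
  move=> uv luv m ml1; apply: uv.
  by rewrite -[u]presented_act1 -[v]presented_act1 -ml1 !actE luv.
split; first exact: congruence_free_of_relations gen.
split; first exact: simple_of_relations gen.
apply: (not_bisimple_of_relations eee xey xeey xy gen).
- exact: (@not_linv _ (0, [::]) (2, [::])).
(* The states of [e * y] and [y * y] are both sent by [x] to that of [y]. *)
- exact: (@not_linv _ (1%N, [:: 0]) (0, [:: 0; 0])).
(* After [e] acts, the leading run is never 0. *)
- move=> m em1; have := presented_act1 (0, [::]).
  by rewrite -em1 !actE /=; case: (presented_act m _).1 => [|[|?]].
(* [a * y * w] leaves a nonempty stack, whereas [e] keeps the empty one empty. *)
- move=> a w ea ayw; have := presented_act_generator letter_e (0, [::]).
  by rewrite -/e -ayw; case: ea; rewrite !actE.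
Qed.
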